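(* Let $n\ge 1$ and let $k,l,m$ be integers with $\gcd(k,l,m,n)=1$. Let $T$ be the $n\times n$ cyclic shift matrix and put $A=3I_n-T^{-k}-T^{k}$, $B=3I_n-T^{-l}-T^{l}$, $C=3I_n-T^{-m}-T^{m}$. Then $Jac(Y(n;k,l,m))$ is isomorphic to the torsion subgroup of $\operatorname{coker}(M)=\mathbb{Z}^{2n}/M\mathbb{Z}^{2n}$, where $M$ is the $2n\times 2n$ integer block matrix $$M=\begin{pmatrix} -A-B+3AB & -A\\ -B & C\end{pmatrix}.$$
   Context: $T=\mathrm{circ}(0,1,0,\ldots,0)$ is the $n\times n$ permutation matrix of the cyclic shift $(x_0,\ldots,x_{n-1})\mapsto(x_1,\ldots,x_{n-1},x_0)$, i.e. $T_{i,i+1}=1$ with indices mod $n$, all other entries $0$; $I_n$ is the identity matrix. The $Y$-graph $Y(n;k,l,m)$ is the (multi)graph with vertices $v_{x,y}$, $x\in\{0,1,2,3\}$, $y\in\mathbb{Z}_n$, and edges $v_{1,y}v_{1,y+k}$, $v_{2,y}v_{2,y+l}$, $v_{3,y}v_{3,y+m}$ and $v_{i,y}v_{0,y}$ for $i=1,2,3$, for all $y\in\mathbb{Z}_n$ (indices mod $n$). With the vertices ordered by $x=0,1,2,3$, its Laplacian matrix (degree matrix minus adjacency matrix) is $$L=\begin{pmatrix}3I_n&-I_n&-I_n&-I_n\\-I_n&A&0&0\\-I_n&0&B&0\\-I_n&0&0&C\end{pmatrix}.$$ For an integer $N\times N$ matrix $X$, $\operatorname{coker}(X)=\mathbb{Z}^N/X\mathbb{Z}^N$.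 The Jacobian group $Jac(Y(n;k,l,m))$ is defined as the torsion subgroup of $\operatorname{coker}(L)$. *)

(* Defs.v *)
From HB Require Import structures.
From mathcomp Require Import all_boot all_order all_algebra.
From mathcomp Require Import boolp.

Set Implicit Arguments.
Unset Strict Implicit.
Unset Printing Implicit Defensive.

Import GRing.Theory.
Local Open Scope ring_scope.

(* Abelian groups are zmodTypes throughout. *)

Section Torsion.
Variable G : zmodType.

Definition torsion : {pred G} :=
  fun x => `[< exists2 d : nat, (0 < d)%N & x *+ d = 0 >].

Lemma torsion_zmod_closed : zmod_closed torsion.
Proof.
split; first by apply/asboolP; exists 1%N.
move=> x y /asboolP[d d0 xd] /asboolP[e e0 ye]; apply/asboolP.
exists (d * e)%N; first by rewrite muln_gt0 d0.
by rewrite mulrnBl mulrnA xd mul0rn mulnC mulrnA ye mul0rn subr0.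
Qed.
HB.instance Definition _ := GRing.isZmodClosed.Build G torsion
  torsion_zmod_closed.

Record torsion_subgroup :=
  TorsionElt { torsion_val : G; _ : torsion_val \in torsion }.
HB.instance Definition _ := [isSub for torsion_val].
HB.instance Definition _ := [Choice of torsion_subgroup by <:].
HB.instance Definition _ := [SubChoice_isSubZmodule of torsion_subgroup by <:].

End Torsion.

Section Cokernel.
Variables (N : nat) (X : 'M[int]_N).

(* X Z^N: columns are acted on by X on the left. *)
Definition col_lattice : {pred 'cV[int]_N} :=
  fun v => `[< exists w : 'cV[int]_N, v = X *m w >].

Lemma col_lattice_zmod_closed : zmod_closed col_lattice.
Proof.
split; first by apply/asboolP; exists 0; rewrite mulmx0.
move=> u v /asboolP[a ->] /asboolP[b ->]; apply/asboolP.
by exists (a - b); rewrite mulmxBr.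
Qed.
HB.instance Definition _ := GRing.isZmodClosed.Build 'cV[int]_N col_lattice
  col_lattice_zmod_closed.

Definition coker : zmodType := Quotient.quot col_lattice.

End Cokernel.

Definition group_isom (G H : zmodType) : Prop :=
  exists f : {additive G -> H}, bijective f.

(* A finite multigraph; loops are allowed.  The pair [ends e] carries an
   arbitrary orientation of the edge [e], which does not affect [adjacency]
   or [degree]. *)
Record multigraph := Multigraph {
  vertex : finType;
  edge : finType;
  ends : edge -> vertex * vertex
}.

Section Laplacian.
Variable Gr : multigraph.

(* A loop at u contributes 2 to both [adjacency u u] and [degree u]. *)
Definition adjacency (u v : vertex Gr) : nat :=
  #|[set e | ends e == (u, v)]| + #|[set e | ends e == (v, u)]|.

Definition degree (u : vertex Gr) : nat :=
  #|[set e | (ends e).1 == u]| + #|[set e | (ends e).2 == u]|.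

Definition laplacian : 'M[int]_#|vertex Gr| :=
  \matrix_(i, j) let u := enum_val i in let v := enum_val j in
    ((degree u)%:Z *+ (u == v) - (adjacency u v)%:Z).

Definition Jac : zmodType := torsion_subgroup (coker laplacian).

End Laplacian.

(* Z_n is represented by 'I_n with n written as p.+1.  Only the additive group
   structure of 'I_p.+1 is used, so that p = 0 gives the trivial group. *)
Section YGraph.
Variables (p : nat) (k l m : int).

Definition shift (y : 'I_p.+1) (s : int) : 'I_p.+1 := y + Zp1 *~ s.

Definition Yjump (x : 'I_3) : int := tnth [tuple k; l; m] x.

(* [inl (x, y)] is the edge v_{x+1,y} v_{x+1,y+s} with s the jump of x;
   [inr (x, y)] is the edge v_{x+1,y} v_{0,y}. *)
Definition Yends (e : ('I_3 * 'I_p.+1) + ('I_3 * 'I_p.+1)) :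
    ('I_4 * 'I_p.+1) * ('I_4 * 'I_p.+1) :=
  match e with
  | inl (x, y) => ((lift ord0 x, y), (lift ord0 x, shift y (Yjump x)))
  | inr (x, y) => ((lift ord0 x, y), (ord0, y))
  end.

Definition Ygraph : multigraph := Multigraph Yends.

End YGraph.

Definition Tmx (p : nat) : 'M[int]_p.+1 := \matrix_(i, j) (j == ordS i)%:R.

(* The exponents are integers: [_ ^ s] is the integer power [exprz] in the
   unit ring of square matrices. *)
Definition circ3 (p : nat) (s : int) : 'M[int]_p.+1 :=
  3%:M - Tmx p ^ (- s) - Tmx p ^ s.

Definition Mmx (p : nat) (k l m : int) : 'M[int]_(p.+1 + p.+1) :=
  let A := circ3 p k in let B := circ3 p l in let C := circ3 p m in
  block_mx (- A - B + 3 *: (A *m B)) (- A)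
           (- B)                     C.

(* Main.v *)
(** Over [Z[T, T^-1]] the cokernel of [L] has generators [e0, ..., e3] and
    relations [3 e0 = e1 + e2 + e3], [A e1 = e0], [B e2 = e0], [C e3 = e0].
    Eliminating [e0 = A e1] and then [e2 = (3 A - 1) e1 - e3] leaves [e1, e3]
    with the relations [(3 A B - A - B) e1 = B e3] and [C e3 = A e1], which are
    the columns of [M].  Hence the cokernels are isomorphic, and so are
    their torsion subgroups. *)
Require Import Defs.
From HB Require Import structures.
From mathcomp Require Import all_boot all_order all_algebra.
From mathcomp Require Import boolp ring.

Set Implicit Arguments.
Unset Strict Implicit.
Unset Printing Implicit Defensive.

Import GRing.Theory.
Local Open Scope ring_scope.
Local Open Scope quotient_scope.

(** * Functoriality of the torsion subgroup *)

Section TorsionFunctoriality.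
Variables (G H : zmodType) (f : {additive G -> H}).

Lemma raddf_torsion (x : G) : x \in @torsion G -> f x \in @torsion H.
Proof.
move=> /asboolP[d d0 xd]; apply/asboolP; exists d => //.
by rewrite -raddfMn xd raddf0.
Qed.

Definition torsion_map (x : torsion_subgroup G) : torsion_subgroup H :=
  TorsionElt (raddf_torsion (valP x)).

Lemma torsion_map_is_zmod_morphism : zmod_morphism torsion_map.
Proof. by move=> x y; apply: val_inj; rewrite /= !raddfB. Qed.

HB.instance Definition _ :=
  GRing.isZmodMorphism.Build (torsion_subgroup G) (torsion_subgroup H)
    torsion_map torsion_map_is_zmod_morphism.

End TorsionFunctoriality.

Lemma torsion_group_isom (G H : zmodType) (f : {additive G -> H})
    (g : {additive H -> G}) :
    cancel f g -> cancel g f ->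
  group_isom (torsion_subgroup G) (torsion_subgroup H).
Proof.
move=> fK gK; exists (torsion_map f).
exists (torsion_map g) => x; apply: val_inj; first exact: fK.
exact: gK.
Qed.

(** * Maps of cokernels induced by integer matrices *)

Section CokernelMap.
Variables (m n : nat) (X : 'M[int]_m) (Y : 'M[int]_n).

Lemma eq_coker (u v : 'cV[int]_m) (w : 'cV[int]_m) :
  u - v = X *m w -> \pi_(coker X) u = \pi_(coker X) v.
Proof.
move=> uv; apply/eqP; rewrite -Quotient.idealrBE.
by apply/asboolP; exists w.
Qed.

Lemma repr_coker (u : 'cV[int]_m) :
  exists w, repr (\pi_(coker X) u) - u = X *m w.
Proof.
apply/asboolP; have: repr (\pi_(coker X) u) - u \in col_lattice X.
  by rewrite Quotient.idealrBE reprK.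
by [].
Qed.

(** A chosen representative makes this total for every [P]; independence of the choice comes from a
    relation [P *m X = Y *m U]. *)
Definition coker_map (P : 'M[int]_(n, m)) (x : coker X) : coker Y :=
  \pi_(coker Y) (P *m repr x).

End CokernelMap.

Section CokernelMorphism.
Variables (m n : nat) (X : 'M[int]_m) (Y : 'M[int]_n).
Variables (P : 'M[int]_(n, m)) (U : 'M[int]_(n, m)).
Hypothesis PX : P *m X = Y *m U.

Lemma coker_map_pi u :
  coker_map Y P (\pi_(coker X) u) = \pi_(coker Y) (P *m u).
Proof.
(* The representative differs from [u] by [X *m w], which [P] sends to [Y *m (U *m w)]. *)
have [w uw] := repr_coker X u.
by apply: (@eq_coker _ _ _ _ (U *m w)); rewrite -mulmxBr uw !mulmxA PX.
Qed.

Lemma coker_map_is_zmod_morphism : zmod_morphism (@coker_map m n X Y P).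
Proof.
move=> x y; rewrite -[x]reprK -[y]reprK -raddfB !coker_map_pi.
by rewrite mulmxBr raddfB.
Qed.

End CokernelMorphism.

(** The relations with [U] and [V] let [P] and [Q] descend to the cokernels; those with [W] and [Z]
    make the induced maps mutually inverse, as each composite moves a vector only by a lattice
    element. *)
Lemma torsion_coker_isom (m n : nat) (X : 'M[int]_m) (Y : 'M[int]_n)
    (P U : 'M[int]_(n, m)) (Q V : 'M[int]_(m, n))
    (W : 'M[int]_m) (Z : 'M[int]_n) :
    P *m X = Y *m U -> Q *m Y = X *m V ->
    Q *m P - 1%:M = X *m W -> P *m Q - 1%:M = Y *m Z ->
  group_isom (torsion_subgroup (coker X)) (torsion_subgroup (coker Y)).
Proof.
move=> PX QY QP PQ.
(* Additivity depends on [PX], so the structure is packed locally. *)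
pose f := HB.pack_for {additive coker X -> coker Y} (@coker_map _ _ X Y P)
  (GRing.isZmodMorphism.Build _ _ (@coker_map _ _ X Y P)
    (coker_map_is_zmod_morphism PX)).
pose g := HB.pack_for {additive coker Y -> coker X} (@coker_map _ _ Y X Q)
  (GRing.isZmodMorphism.Build _ _ (@coker_map _ _ Y X Q)
    (coker_map_is_zmod_morphism QY)).
apply: (@torsion_group_isom _ _ f g) => x.
  rewrite -[x]reprK /= (coker_map_pi PX) (coker_map_pi QY).
  by apply: (@eq_coker _ _ _ _ (W *m repr x)); rewrite !mulmxA -QP mulmxBl mul1mx.
rewrite -[x]reprK /= (coker_map_pi QY) (coker_map_pi PX).
by apply: (@eq_coker _ _ _ _ (Z *m repr x)); rewrite !mulmxA -PQ mulmxBl mul1mx.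
Qed.

(** * Block columns of matrices whose columns are indexed by pairs *)

Section BlockColumns.
Variables (I : finType) (q : nat).
Local Notation N := #|{: I * 'I_q}|.

(** The inclusion of block [x]: right multiplication by it extracts a block column, and it stands
    for the generator [e_x]. *)
Definition block_inj (x : I) : 'M[int]_(N, q) :=
  \matrix_(i, j) (enum_val i == (x, j))%:R.

Definition block_cols m (F : I -> 'M[int]_(m, q)) : 'M[int]_(m, N) :=
  \matrix_(i, j) F (enum_val j).1 i (enum_val j).2.

Lemma mulmx_block_inj m (F : 'M[int]_(m, N)) x :
  F *m block_inj x = \matrix_(i, j) F i (enum_rank (x, j)).
Proof.
apply/matrixP=> i j; rewrite !mxE (bigD1 (enum_rank (x, j))) //=.
rewrite mxE enum_rankK eqxx mulr1 big1 ?addr0 // => h /negPf hx.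
by rewrite mxE (can2_eq enum_valK enum_rankK) hx mulr0.
Qed.

Lemma block_colsE m (F : I -> 'M[int]_(m, q)) x :
  block_cols F *m block_inj x = F x.
Proof.
by apply/matrixP=> i j; rewrite mulmx_block_inj !mxE enum_rankK.
Qed.

(** Every column index is the rank of a pair [(x, j)], so matrix equations can be checked generator
    by generator. *)
Lemma block_injP m (F G : 'M[int]_(m, N)) :
  (forall x, F *m block_inj x = G *m block_inj x) -> F = G.
Proof.
move=> FG; apply/matrixP=> i j.
have := congr1 (fun K : 'M_(m, q) => K i (enum_val j).2) (FG (enum_val j).1).
by rewrite !mulmx_block_inj !mxE -surjective_pairing enum_valK.
Qed.

End BlockColumns.

(** * Integer powers of the cyclic shift matrix *)

Section ShiftMatrix.
Variable p : nat.

Definition shift_mx (s : int) : 'M[int]_p.+1 :=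
  \matrix_(i, j) (j == shift i s)%:R.

Lemma shiftD (y : 'I_p.+1) s t : shift y (s + t) = shift (shift y s) t.
Proof. by rewrite /shift mulrzDr addrA. Qed.

Lemma shift0 (y : 'I_p.+1) : shift y 0 = y.
Proof. by rewrite /shift mulr0z addr0. Qed.

Lemma eq_shiftN (y z : 'I_p.+1) s : (y == shift z (- s)) = (z == shift y s).
Proof. by rewrite /shift mulrNz eq_sym subr_eq. Qed.

Lemma shift_mx0 : shift_mx 0 = 1.
Proof. by apply/matrixP=> i j; rewrite !mxE shift0 eq_sym. Qed.

Lemma shift_mxD s t : shift_mx (s + t) = shift_mx s * shift_mx t.
Proof.
apply/matrixP=> i j; rewrite !mxE (bigD1 (shift i s)) //= !mxE eqxx mul1r.
rewrite big1 ?addr0 ?shiftD // => h /negPf hi.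
by rewrite !mxE hi mul0r.
Qed.

Lemma Tmx_shift : Tmx p = shift_mx 1.
Proof.
apply/matrixP=> i j; rewrite !mxE; congr (_ == _)%:R; apply: val_inj => /=.
by rewrite modnDmr addn1.
Qed.

Lemma Tmx_exprz s : Tmx p ^ s = shift_mx s.
Proof.
have T1 : Tmx p * shift_mx (-1) = 1 by rewrite Tmx_shift -shift_mxD shift_mx0.
have T2 : shift_mx (-1) * Tmx p = 1 by rewrite Tmx_shift -shift_mxD shift_mx0.
have uT : Tmx p \is a GRing.unit by apply/unitrP; exists (shift_mx (-1)).
have Tn (n : nat) : Tmx p ^+ n = shift_mx n%:Z.
  elim: n => [|n IHn]; first by rewrite expr0 shift_mx0.
  by rewrite exprS IHn Tmx_shift -shift_mxD.
case: (intP s) => [|n|n]; [by rewrite expr0z shift_mx0 | exact: Tn |].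
(* For a negative exponent, the unit [Tmx p ^+ n.+1] is cancelled to reduce to nonnegative
   powers. *)
apply: (@mulrI _ (Tmx p ^+ n.+1)); first exact: unitrX.
by rewrite mulrV ?unitrX // Tn -shift_mxD subrr shift_mx0.
Qed.

(** [eq_shiftN] rewrites the entry of [T^(-s)], so that the subtracted terms are the two
    orientations of a jump edge. *)
Lemma circ3E s i j :
  circ3 p s i j =
    3 *+ (i == j) - (i == shift j s)%:R - (j == shift i s)%:R.
Proof. by rewrite /circ3 !Tmx_exprz !mxE eq_shiftN. Qed.

End ShiftMatrix.

(** * Cardinalities of edge sets *)

Lemma card_set_sum (S1 S2 : finType) (P : pred (S1 + S2)) :
  #|[set e | P e]| =
    (#|[set x | P (inl x)]| + #|[set x | P (inr x)]|)%N.
Proof. by rewrite -!sum1dep_card big_sumType. Qed.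

Lemma card_set_pred0 (S : finType) (P : pred S) :
  P =1 xpred0 -> #|[set x | P x]| = 0%N.
Proof. by move=> P0; apply: eq_card0 => x; rewrite !inE P0. Qed.

(** The flag [c] holds a condition independent of the edge; the set is a singleton or empty
    accordingly. *)
Lemma card_set_pred1 (S : finType) (P : pred S) (a : S) (c : bool) :
  (forall x, P x = (x == a) && c) -> #|[set x | P x]| = c.
Proof.
move=> Pa; case: c Pa => Pa.
  by rewrite [RHS]/= -(cards1 a); apply: eq_card => x; rewrite !inE Pa andbT.
by apply: card_set_pred0 => x; rewrite Pa andbF.
Qed.

(** * The Laplacian of the Y-graph by block columns *)

Section YLaplacian.
Variables (p : nat) (k l m : int).
Local Notation Y := (Ygraph p k l m).
Local Notation J := (Yjump k l m).
Local Notation L := (laplacian Y).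

Lemma lift0_inj_eq (a b : 'I_3) : (lift ord0 a == lift ord0 b :> 'I_4) = (a == b).
Proof. exact: (inj_eq lift_inj). Qed.

Lemma lift0_neq0 (a : 'I_3) : (lift ord0 a == ord0 :> 'I_4) = false.
Proof. by []. Qed.

Lemma neq0_lift0 (a : 'I_3) : (ord0 == lift ord0 a :> 'I_4) = false.
Proof. by []. Qed.

Let endE := (xpair_eqE, lift0_inj_eq, lift0_neq0, neq0_lift0, andbF, andFb).

(** An outer vertex is the first end of one jump edge and one spoke, and the second end of one jump
    edge; a central vertex is the second end of three spokes. *)
Lemma degree_Ygraph (u : vertex Y) : degree u = 3%N.
Proof.
case: u => x y; rewrite /degree !card_set_sum /=.
case: (unliftP ord0 x) => [a|] ->.
  rewrite (@card_set_pred1 _ _ (a, y) true); last by case=> b z; rewrite !endE andbT.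
  rewrite (@card_set_pred1 _ _ (a, y) true); last by case=> b z; rewrite !endE andbT.
  (* The jump edge arriving at [y] starts at [y - J a]. *)
  rewrite (@card_set_pred1 _ _ (a, shift y (- J a)) true); last first.
    case=> b z; rewrite !endE andbT eq_shiftN.
    by case: eqP => [->|//]; rewrite eq_sym.
  by rewrite card_set_pred0 // => -[b z]; rewrite !endE.
do 3!(rewrite card_set_pred0; last by case=> b z; rewrite !endE).
rewrite !add0n -[RHS]card_ord.
transitivity #|[set (a, y) | a : 'I_3]|; last by rewrite card_imset // => a b [].
apply: eq_card => -[b z]; rewrite !inE /= xpair_eqE eqxx /=.
by apply/eqP/imsetP => [->|[a _ [_ ->]]] //; exists b.
Qed.

Lemma adjacency_00 y z : @adjacency Y (ord0, y) (ord0, z) = 0%N.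
Proof.
rewrite /adjacency !card_set_sum /=.
by rewrite !card_set_pred0 // => -[b t]; rewrite !endE.
Qed.

Lemma adjacency_sym (G : multigraph) (u v : vertex G) :
  adjacency u v = adjacency v u.
Proof. by rewrite /adjacency addnC. Qed.

Lemma adjacency_l0 a y z :
  @adjacency Y (lift ord0 a, y) (ord0, z) = (y == z).
Proof.
rewrite /adjacency !card_set_sum /=.
rewrite card_set_pred0; last by case=> b t; rewrite !endE.
rewrite (@card_set_pred1 _ _ (a, y) (y == z)); last first.
  by case=> b t; rewrite !endE; case: (t =P y) => [->|]; rewrite ?andbT ?andbF.
by rewrite !card_set_pred0 ?addn0 // => -[b t]; rewrite !endE.
Qed.

(** Each orientation of a jump edge gives one summand; both are 1 for a loop, and for the double
    edge arising when twice the jump vanishes mod [p.+1]. *)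
Lemma adjacency_ll a b y z :
  @adjacency Y (lift ord0 a, y) (lift ord0 b, z) =
    ((a == b) && (z == shift y (J a)) + (a == b) && (y == shift z (J a)))%N.
Proof.
rewrite /adjacency !card_set_sum /=.
rewrite (@card_set_pred1 _ _ (a, y) ((a == b) && (z == shift y (J a)))); last first.
  case=> c t; rewrite !endE [z == _]eq_sym.
  by case: (c =P a) => [->|//]; case: (t =P y) => [->|]; rewrite ?andbF.
rewrite card_set_pred0; last by case=> c t; rewrite !endE.
rewrite (@card_set_pred1 _ _ (b, z) ((a == b) && (y == shift z (J a)))); last first.
  case=> c t; rewrite !endE [y == _]eq_sym [a == b]eq_sym.
  case: (c =P b) => [->|//]; case: (t =P z) => [->|]; rewrite ?andbF //=.
  by case: eqP => [->|].
by rewrite card_set_pred0 ?addn0 // => -[c t]; rewrite !endE.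
Qed.

Lemma laplacian_Ygraph (i : 'I_#|vertex Y|) (v : vertex Y) :
  L i (enum_rank v) = 3 *+ (enum_val i == v) - (adjacency (enum_val i) v)%:Z.
Proof. by rewrite mxE /= enum_rankK degree_Ygraph. Qed.

Local Notation E := (@block_inj 'I_4 p.+1).

(** The relation [3 e0 = e1 + e2 + e3]: a central vertex has one spoke to each outer index. *)
Lemma laplacian_block0 :
  L *m E ord0 = 3 *: E ord0 - \sum_(a < 3) E (lift ord0 a).
Proof.
apply/matrixP=> i j; rewrite mulmx_block_inj mxE laplacian_Ygraph !mxE summxE.
have -> : \sum_(a < 3) E (lift ord0 a) i j =
   \sum_(a < 3) (enum_val i == (lift ord0 a, j))%:R by apply: eq_bigr => a _; rewrite mxE.
case: (enum_val i) => x y; case: (unliftP ord0 x) => [a|] ->.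
  rewrite adjacency_l0 (bigD1 a) //= big1 ?addr0 => [|b /negPf ba].
    by rewrite !endE eqxx [(_ && _)%:R]natz mulr0.
  by rewrite !endE eq_sym ba.
rewrite adjacency_00 big1 ?subr0 => [|b _]; last by rewrite !endE.
by case: (_ == _).
Qed.

(** The relations [A e1 = e0], [B e2 = e0], [C e3 = e0]: on outer rows [adjacency_ll] matches
    [circ3E], and the spokes give [- E ord0]. *)
Lemma laplacian_block_lift a :
  L *m E (lift ord0 a) = E (lift ord0 a) *m circ3 p (J a) - E ord0.
Proof.
apply/matrixP=> i j; rewrite mulmx_block_inj mxE laplacian_Ygraph !mxE.
have -> : \sum_h E (lift ord0 a) i h * circ3 p (J a) h j =
   \sum_h (enum_val i == (lift ord0 a, h))%:R * circ3 p (J a) h j.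
  by apply: eq_bigr => h _; rewrite mxE.
case: (enum_val i) => x y; case: (unliftP ord0 x) => [b|] ->.
  rewrite !endE subr0 adjacency_ll (bigD1 y) //= big1 ?addr0 => [|h /negPf hy].
    rewrite !endE eqxx andbT circ3E; case: (b =P a) => [->|_] /=.
      by rewrite mul1r PoszD opprD !natz addrAC addrA.
    by rewrite mul0r subr0.
  by rewrite !endE [y == h]eq_sym hy andbF mul0r.
rewrite adjacency_sym adjacency_l0 big1 => [|h _].
  by rewrite !endE eqxx eq_sym natz.
by rewrite !endE mul0r.
Qed.

End YLaplacian.

(** * Elimination of [e0] and [e2] from the presentation *)

Section Elimination.
Variable q : nat.
(** Iterated lifts are the form produced by [unliftP] and [big_ord_recl]. *)
Local Notation i1 := (lift ord0 (ord0 : 'I_3)).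
Local Notation i2 := (lift ord0 (lift ord0 (ord0 : 'I_2))).
Local Notation i3 := (lift ord0 (lift ord0 (lift ord0 (ord0 : 'I_1)))).
Local Notation E0 := (@block_inj 'I_4 q ord0).
Local Notation E1 := (@block_inj 'I_4 q i1).
Local Notation E2 := (@block_inj 'I_4 q i2).
Local Notation E3 := (@block_inj 'I_4 q i3).
Local Notation N := #|{: 'I_4 * 'I_q}|.

Lemma block4P n (F G : 'M[int]_(n, N)) :
    F *m E0 = G *m E0 -> F *m E1 = G *m E1 -> F *m E2 = G *m E2 ->
    F *m E3 = G *m E3 ->
  F = G.
Proof.
move=> ? ? ? ?; apply: block_injP => x.
case: (unliftP ord0 x) => [a|] -> //; case: (unliftP ord0 a) => [b|] -> //.
by case: (unliftP ord0 b) => [c|] -> //; rewrite (ord1 c).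
Qed.

(** The map sending [e0, ..., e3] to the given images; the default 0 of [nth] is never reached. *)
Definition blocks4 n (G0 G1 G2 G3 : 'M[int]_(n, q)) : 'M[int]_(n, N) :=
  block_cols (fun x : 'I_4 => nth 0 [:: G0; G1; G2; G3] x).

Lemma blocks4E n (G0 G1 G2 G3 : 'M[int]_(n, q)) (G := blocks4 G0 G1 G2 G3) :
  (G *m E0 = G0) * (G *m E1 = G1) * (G *m E2 = G2) * (G *m E3 = G3).
Proof. by rewrite /G /blocks4 !block_colsE. Qed.

Variables (A B C : 'M[int]_q) (L : 'M[int]_N).
Hypothesis LE0 : L *m E0 = 3 *: E0 - E1 - E2 - E3.
Hypothesis LE1 : L *m E1 = E1 *m A - E0.
Hypothesis LE2 : L *m E2 = E2 *m B - E0.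
Hypothesis LE3 : L *m E3 = E3 *m C - E0.

Local Notation F1 := (col_mx 1%:M 0 : 'M[int]_(q + q, q)).
Local Notation F2 := (col_mx 0 1%:M : 'M[int]_(q + q, q)).
Local Notation M := (block_mx (- A - B + 3 *: (A *m B)) (- A) (- B) C).

Lemma elim_mxF1 : M *m F1 = 3 *: (F1 *m A *m B) - F1 *m A - F1 *m B - F2 *m B.
Proof.
rewrite mul_block_col !mul_col_mx !mulmx1 !mulmx0 !mul1mx !mul0mx !addr0.
rewrite scale_col_mx scaler0 !opp_col_mx !add_col_mx oppr0 !addr0 sub0r.
by congr (col_mx _ _); rewrite addrC addrA.
Qed.

Lemma elim_mxF2 : M *m F2 = F2 *m C - F1 *m A.
Proof.
rewrite mul_block_col !mul_col_mx !mulmx1 !mulmx0 !mul1mx !mul0mx !add0r.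
by rewrite opp_col_mx add_col_mx oppr0 addr0 sub0r.
Qed.

Lemma torsion_coker_elim :
  group_isom (torsion_subgroup (coker L)) (torsion_subgroup (coker M)).
Proof.
apply: (@torsion_coker_isom _ _ _ _
  (* [P] substitutes [e0 = A e1] and [e2 = (3 A - 1) e1 - e3], with [F1], [F2] standing for [e1],
     [e3]. *)
  (blocks4 (F1 *m A) F1 (3 *: (F1 *m A) - F1 - F2) F2)
  (* The relations of blocks 0 and 1 are spent on the elimination and become 0; those of blocks 2
     and 3 become the columns of [M]. [Q] includes [e1] and [e3]. *)
  (blocks4 0 0 F1 F2) (row_mx E1 E3)
  (* The columns of [M] recovered from the relations of [L]; the [E0] terms cancel. *)
  (row_mx (3 *: (E1 *m B) + E0 *m B + E2 - E1) (E3 - E1))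
  (* Relation 1 gives [A e1 - e0]; three times it plus relation 0 gives [3 A e1 - e1 - e2 - e3], the
     error of the substitution for [e2]. [P *m Q] is exactly the identity. *)
  (blocks4 E1 0 (3 *: E1 + E0) 0) 0).
- apply: block4P; rewrite -!mulmxA !blocks4E ?mulmx0.
  + rewrite LE0 !mulmxBr -scalemxAr !blocks4E.
    by apply/matrixP => i j; rewrite !mxE; ring.
  + by rewrite LE1 mulmxBr mulmxA !blocks4E subrr.
  + rewrite LE2 mulmxBr mulmxA !blocks4E elim_mxF1 !mulmxBl -scalemxAl.
    by apply/matrixP => i j; rewrite !mxE; ring.
  + by rewrite LE3 mulmxBr mulmxA !blocks4E elim_mxF2.
- rewrite mul_row_block mul_mx_row; congr (row_mx _ _).
    rewrite !mulmxDr !mulmxN -!scalemxAr !mulmxA LE0 LE1 LE2.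
    rewrite !mulmxBl -!scalemxAl.
    by apply/matrixP => i j; rewrite !mxE; ring.
  rewrite mulmxN !mulmxDr mulmxN LE1 LE3.
  by apply/matrixP => i j; rewrite !mxE; ring.
- apply: block4P; rewrite mulmxBl mul1mx -!mulmxA !blocks4E ?mulmx0.
  + by rewrite LE1 mulmxA mul_row_col mulmx1 mulmx0 addr0.
  + by rewrite mul_row_col mulmx1 mulmx0 addr0 subrr.
  + rewrite !mulmxBr mulmxDr -!scalemxAr LE1 LE0 mulmxA !mul_row_col.
    rewrite !mulmx1 !mulmx0 addr0 add0r.
    by apply/matrixP => i j; rewrite !mxE; ring.
  + by rewrite mul_row_col mulmx1 mulmx0 add0r subrr.
- rewrite mulmx0 mul_mx_row !blocks4E; apply/eqP; rewrite subr_eq0; apply/eqP.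
  by rewrite scalar_mx_block block_mxEh.
Qed.

End Elimination.

Theorem theorem1 (p : nat) (k l m : int)
    (hgcd : gcdz (gcdz (gcdz k l) m) (p.+1)%:Z = 1) :
  group_isom (Jac (Ygraph p k l m)) (torsion_subgroup (coker (Mmx p k l m))).
Proof.
apply: torsion_coker_elim; rewrite ?laplacian_block_lift //.
by rewrite laplacian_block0 !big_ord_recl big_ord0 addr0 !opprD !addrA.
Qed.
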